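(* Let $\mathfrak g=\mathfrak g_{\bar 0}\oplus\mathfrak g_{\bar 1}$ be a finite-dimensional Lie superalgebra over $\mathbb C$, $\mathcal U=U(\mathfrak g)$, let $\mathcal A$ be a sub-Hopf-superalgebra of the finite dual $\mathcal U^\circ$, let $\mathcal P:\mathcal U^\circ\to U(\mathfrak g_{\bar 0})^\circ$ be the restriction map, and let $\int_0:\mathcal A_e\to\mathbb C$ be a left integral on $\mathcal A_e=\mathcal P(\mathcal A)$ with $\int_0 1_{\mathcal A_e}=1$. Let $J=\mathcal U\mathfrak g_{\bar 0}$ and let $z\in\mathcal U$ be such that $z+J\in\mathcal U/J$ is invariant, i.e. $x(z+J)=\varepsilon(x)z+J$ for all $x\in\mathcal U$. Then the linear form $$\int=\nu(z)\cdot\Big(\int_0\circ\,\mathcal P|_{\mathcal A}\Big)$$ is a left integral on $\mathcal A$ and does not depend on the choice of the representative $z$ of $z+J$. If $z\notin J$ and if the matrix elements of the $\mathcal U$-module $\mathcal U/J$ belong to $\mathcal A$, then the integral $\int$ is not equal to zero.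
   Context: Everything is over $\mathbb C$ and $\mathbb Z_2$-graded, with the super sign rule; $[x]$ is the degree of a homogeneous element. $U(\mathfrak g)$ is the enveloping algebra with its usual Hopf superalgebra structure; $\varepsilon$ is its counit. The finite dual $\mathcal U^\circ\subset\mathcal U^*$ of a Hopf superalgebra $\mathcal U$ is the Hopf superalgebra of linear forms that are matrix elements of finite-dimensional (graded) representations of $\mathcal U$, with structure obtained by transposition: $\langle ab,x\rangle=\langle a\otimes b,\Delta(x)\rangle$, $\langle\Delta(a),x\otimes y\rangle=\langle a,xy\rangle$, where $\langle a\otimes b,x\otimes y\rangle=(-1)^{[b][x]}\langle a,x\rangle\langle b,y\rangle$. The map $\mathcal P$ is $\langle\mathcal P(a),u\rangle=\langle a,u\rangle$ for $u\in U(\mathfrak g_{\bar 0})\subset U(\mathfrak g)$; it is a Hopf superalgebra map, and $\mathcal A_e=\mathcal P(\mathcal A)$ is a Hopf subalgebra of $U(\mathfrak g_{\bar 0})^\circ$. The map $\nu:\mathcal U\to\mathcal A^\circ\subset\mathcal A^*$ is $\langle\nu(x),a\rangle=(-1)^{[x][a]}\langle a,x\rangle$. The product in $\mathcal A^*$ is $\langle f\cdot g,a\rangle=\langle f\otimes g,\Delta(a)\rangle$. A left integral on a Hopf superalgebra $\mathcal B$ is a linear form $\int$ on $\mathcal B$ with $(\mathrm{id}_{\mathcal B}\otimes\int)\Delta(b)=1_{\mathcal B}\int(b)$ for all $b\in\mathcal B$. $J$ is the left ideal of $\mathcal U$ generated by $\mathfrak g_{\bar 0}$, and $\mathcal U/J$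 is a left $\mathcal U$-module via $x(y+J)=xy+J$; it is finite-dimensional. Its matrix elements are the linear forms $\pi_{i,j}$ on $\mathcal U$ given by $x v_j=\sum_i\pi_{i,j}(x)v_i$ for a homogeneous basis $(v_i)$. *)

(* Defs.v *)
From HB Require Import structures.
From mathcomp Require Import all_boot all_order all_algebra.
From mathcomp Require Import boolp classical_sets reals complex.

Set Implicit Arguments.
Unset Strict Implicit.
Unset Printing Implicit Defensive.
Import GRing.Theory Num.Theory.

Local Open Scope ring_scope.
Local Open Scope quotient_scope.
Local Open Scope classical_set_scope.

Lemma lin_zero (K : pzRingType) (V W : lmodType K) (f : V -> W) :
  linear f -> f 0 = 0.
Proof. by move=> fl; have := fl (-1) 0 0; rewrite !scaleN1r !addNr. Qed.
Lemma lin_Z (K : pzRingType) (V W : lmodType K) (f : V -> W) c x :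
  linear f -> f (c *: x) = c *: f x.
Proof. by move=> fl; have := fl c x 0; rewrite (lin_zero fl) !addr0. Qed.

Section Tensor.
Variables (K : fieldType) (V W : lmodType K).

(* V (x) W by generators v (x) w and the bilinearity relations. *)
Inductive tterm : Type :=
  | TPure of V & W
  | TZero
  | TAdd of tterm & tterm
  | TScale of K & tterm.

Inductive teq : tterm -> tterm -> Prop :=
  | teq_refl s : teq s s
  | teq_sym s t : teq s t -> teq t s
  | teq_trans s t u : teq s t -> teq t u -> teq s u
  | teq_add s s' t t' : teq s s' -> teq t t' -> teq (TAdd s t) (TAdd s' t')
  | teq_scale c s s' : teq s s' -> teq (TScale c s) (TScale c s')
  | teq_addA s t u : teq (TAdd s (TAdd t u)) (TAdd (TAdd s t) u)
  | teq_addC s t : teq (TAdd s t) (TAdd t s)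
  | teq_add0 s : teq (TAdd TZero s) s
  | teq_addN s : teq (TAdd (TScale (-1) s) s) TZero
  | teq_scaleA c d s : teq (TScale c (TScale d s)) (TScale (c * d) s)
  | teq_scale1 s : teq (TScale 1 s) s
  | teq_scaleDr c s t : teq (TScale c (TAdd s t)) (TAdd (TScale c s) (TScale c t))
  | teq_scaleDl s c d : teq (TScale (c + d) s) (TAdd (TScale c s) (TScale d s))
  | teq_linl c v v' w :
      teq (TPure (c *: v + v') w) (TAdd (TScale c (TPure v w)) (TPure v' w))
  | teq_linr c v w w' :
      teq (TPure v (c *: w + w')) (TAdd (TScale c (TPure v w)) (TPure v w')).

HB.instance Definition _ := gen_eqMixin tterm.
HB.instance Definition _ := gen_choiceMixin tterm.

Definition teqb (s t : tterm) : bool := `[< teq s t >].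

Lemma teqb_refl : reflexive teqb.
Proof. by move=> s; apply/asboolP; exact: teq_refl. Qed.
Lemma teqb_sym : symmetric teqb.
Proof. by move=> s t; apply/asboolP/asboolP; exact: teq_sym. Qed.
Lemma teqb_trans : transitive teqb.
Proof.
by move=> t s u /asboolP st /asboolP tu; apply/asboolP; exact: teq_trans st tu.
Qed.

Canonical teq_equiv := EquivRel teqb teqb_refl teqb_sym teqb_trans.

Definition tensor := {eq_quot teq_equiv}.
HB.instance Definition _ := Choice.on tensor.

Definition tcls (s : tterm) : tensor := \pi_tensor s.
Definition tens (v : V) (w : W) : tensor := tcls (TPure v w).

Lemma tclsP s t : teq s t -> tcls s = tcls t.
Proof. by move=> st; apply/eqmodP; apply/asboolP. Qed.

Lemma tcls_inj s t : tcls s = tcls t -> teq s t.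
Proof. by move/eqmodP/asboolP. Qed.

Lemma tclsK x : tcls (repr x) = x.
Proof. exact: reprK. Qed.

Definition tadd (x y : tensor) := tcls (TAdd (repr x) (repr y)).
Definition tscale c (x : tensor) := tcls (TScale c (repr x)).
Definition topp (x : tensor) := tscale (-1) x.

Lemma tcls_add s t : tcls (TAdd s t) = tadd (tcls s) (tcls t).
Proof. by apply: tclsP; apply: teq_add; apply: tcls_inj; rewrite tclsK. Qed.

Lemma tcls_scale c s : tcls (TScale c s) = tscale c (tcls s).
Proof. by apply: tclsP; apply: teq_scale; apply: tcls_inj; rewrite tclsK. Qed.

Lemma taddA : associative tadd.
Proof.
move=> x y z; rewrite -[x]tclsK -[y]tclsK -[z]tclsK -!tcls_add.
exact/tclsP/teq_addA.
Qed.
Lemma taddC : commutative tadd.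
Proof.
by move=> x y; rewrite -[x]tclsK -[y]tclsK -!tcls_add; apply/tclsP/teq_addC.
Qed.
Lemma tadd0 : left_id (tcls TZero) tadd.
Proof. by move=> x; rewrite -[x]tclsK -tcls_add; apply/tclsP/teq_add0. Qed.
Lemma taddN : left_inverse (tcls TZero) topp tadd.
Proof.
by move=> x; rewrite /topp -[x]tclsK -tcls_scale -tcls_add; apply/tclsP/teq_addN.
Qed.

HB.instance Definition _ :=
  GRing.isZmodule.Build tensor taddA taddC tadd0 taddN.

Lemma tscaleA c d (x : tensor) : tscale c (tscale d x) = tscale (c * d) x.
Proof. by rewrite -[x]tclsK -!tcls_scale; apply/tclsP/teq_scaleA. Qed.
Lemma tscale1 : left_id 1 tscale.
Proof. by move=> x; rewrite -[x]tclsK -tcls_scale; apply/tclsP/teq_scale1. Qed.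
Lemma tscaleDr : right_distributive tscale (@GRing.add tensor).
Proof.
move=> c x y; rewrite -[x]tclsK -[y]tclsK -[_ + _]tcls_add -!tcls_scale.
by rewrite -[RHS]tcls_add; apply/tclsP/teq_scaleDr.
Qed.
Lemma tscaleDl (x : tensor) :
  {morph tscale^~ x : c d / c + d >-> (c + d : tensor)}.
Proof.
move=> c d; rewrite -[x]tclsK -!tcls_scale -[RHS]tcls_add.
exact/tclsP/teq_scaleDl.
Qed.

HB.instance Definition _ := GRing.Zmodule_isLmodule.Build K tensor
  tscaleA tscale1 tscaleDr tscaleDl.

Lemma tens_linl w : linear (tens^~ w).
Proof.
move=> c v v'; rewrite /tens (tclsP (teq_linl c v v' w)) tcls_add tcls_scale //.
Qed.
Lemma tens_linr v : linear (tens v).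
Proof.
move=> c w w'; rewrite /tens (tclsP (teq_linr c v w w')) tcls_add tcls_scale //.
Qed.

Section Lift.
Variables (M : lmodType K) (b : V -> W -> M).

Fixpoint tinterp (s : tterm) : M :=
  match s with
  | TPure v w => b v w
  | TZero => 0
  | TAdd s t => tinterp s + tinterp t
  | TScale c s => c *: tinterp s
  end.

(* The linear map on V (x) W induced by b; meaningful for bilinear b. *)
Definition tlift (x : tensor) : M := tinterp (repr x).

Hypothesis bl : forall w, linear (b^~ w).
Hypothesis br : forall v, linear (b v).

Lemma tinterpP s t : teq s t -> tinterp s = tinterp t.
Proof.
elim=> //=.
- by move=> ? ? ? _ -> _ ->.
- by move=> ? ? ? ? _ -> _ ->.
- by move=> ? ? ? _ ->.
- by move=> *; rewrite addrA.
- by move=> *; rewrite addrC.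
- by move=> *; rewrite add0r.
- by move=> *; rewrite scaleN1r addNr.
- by move=> *; rewrite scalerA.
- by move=> *; rewrite scale1r.
- by move=> *; rewrite scalerDr.
- by move=> *; rewrite scalerDl.
- by move=> *; apply: bl.
- by move=> *; apply: br.
Qed.

Lemma tlift_cls s : tlift (tcls s) = tinterp s.
Proof. by apply: tinterpP; apply: tcls_inj; rewrite tclsK. Qed.

Lemma tlift_tens v w : tlift (tens v w) = b v w.
Proof. by rewrite /tens tlift_cls. Qed.

Lemma tlift_linear : linear tlift.
Proof.
move=> c x y; rewrite -[x in LHS]tclsK -[y in LHS]tclsK.
by rewrite -[c *: _]tcls_scale -[_ + _]tcls_add tlift_cls.
Qed.
End Lift.

Lemma tens_ind (P : tensor -> Prop) :
  (forall v w, P (tens v w)) -> (forall c x y, P x -> P y -> P (c *: x + y)) ->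
  forall x, P x.
Proof.
move=> Pt Pl x; rewrite -[x]tclsK; elim: (repr x) => [v w||s Ps t Pt'|c s Ps].
- exact: Pt.
- have := Pl (-1) _ _ (Pt 0 0) (Pt 0 0).
  by rewrite scaleN1r addNr.
- by rewrite tcls_add -[tcls s]scale1r; apply: Pl.
- have P0 := Pl (-1) _ _ (Pt 0 0) (Pt 0 0); rewrite scaleN1r addNr in P0.
  by have := Pl c _ _ Ps P0; rewrite addr0 tcls_scale.
Qed.

End Tensor.

(* Degrees in Z/2 are booleans: (+) is their sum and && their product. *)
Record lieSuperalgebra (K : numFieldType) := LieSuperalgebra {
  lie_sort :> vectType K;
  gpart : bool -> {vspace lie_sort};
  gpart_direct : (gpart false :&: gpart true = 0)%VS;
  gpart_full : (gpart false + gpart true = fullv)%VS;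
  bracket : lie_sort -> lie_sort -> lie_sort;
  bracket_linl : forall y, linear (bracket^~ y);
  bracket_linr : forall x, linear (bracket x);
  bracket_graded : forall i j x y, x \in gpart i -> y \in gpart j ->
    bracket x y \in gpart (i (+) j);
  bracket_skew : forall i j x y, x \in gpart i -> y \in gpart j ->
    bracket x y = - ((-1) ^+ (i && j) *: bracket y x);
  bracket_jacobi : forall i j x y z, x \in gpart i -> y \in gpart j ->
    bracket x (bracket y z) =
    bracket (bracket x y) z + (-1) ^+ (i && j) *: bracket y (bracket x z)
}.

Section EvenPart.
Variables (K : numFieldType) (g : lieSuperalgebra K).
Let g0 := subvs_of (gpart g false).

Definition even_bracket (x y : g0) : g0 :=
  vsproj (gpart g false) (bracket (vsval x) (vsval y)).

Lemma even_bracketE (x y : g0) :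
  vsval (even_bracket x y) = bracket (vsval x) (vsval y).
Proof. exact/vsprojK/(bracket_graded (subvsP x) (subvsP y)). Qed.

Definition even_gpart (i : bool) : {vspace g0} := if i then 0%VS else fullv.

Lemma even_gpartP i (x : g0) :
  x \in even_gpart i -> vsval x \in gpart g i.
Proof.
case: i => /= [|_]; last exact: subvsP.
by rewrite memv0 => /eqP ->; rewrite linear0 mem0v.
Qed.

Fact even_direct : (even_gpart false :&: even_gpart true = 0)%VS.
Proof. exact: capv0. Qed.
Fact even_full : (even_gpart false + even_gpart true = fullv)%VS.
Proof. exact: addv0. Qed.
Fact even_linl y : linear (even_bracket^~ y).
Proof.
move=> c x x'; apply: subvs_inj; rewrite linearP /= !even_bracketE linearP.
exact: (bracket_linl (vsval y) c (vsval x) (vsval x')).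
Qed.
Fact even_linr x : linear (even_bracket x).
Proof.
move=> c y y'; apply: subvs_inj; rewrite linearP /= !even_bracketE linearP.
exact: (bracket_linr (vsval x) c (vsval y) (vsval y')).
Qed.
Fact even_graded i j x y : x \in even_gpart i -> y \in even_gpart j ->
  even_bracket x y \in even_gpart (i (+) j).
Proof.
case: i j => [] [] //=; rewrite ?memvf // !memv0.
- by move=> /eqP -> _; rewrite (lin_zero (even_linl y)).
- by move=> _ /eqP ->; rewrite (lin_zero (even_linr x)).
Qed.
Fact even_skew i j x y : x \in even_gpart i -> y \in even_gpart j ->
  even_bracket x y = - ((-1) ^+ (i && j) *: even_bracket y x).
Proof.
move=> xi yj; apply: subvs_inj; rewrite linearN linearZ /= !even_bracketE scalerN.
exact: bracket_skew (even_gpartP xi) (even_gpartP yj).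
Qed.
Fact even_jacobi i j x y z : x \in even_gpart i -> y \in even_gpart j ->
  even_bracket x (even_bracket y z) =
  even_bracket (even_bracket x y) z
  + (-1) ^+ (i && j) *: even_bracket y (even_bracket x z).
Proof.
move=> xi yj; apply: subvs_inj; rewrite linearD linearZ /= !even_bracketE.
exact: bracket_jacobi (even_gpartP xi) (even_gpartP yj).
Qed.

Definition even_lie : lieSuperalgebra K :=
  LieSuperalgebra even_direct even_full even_linl even_linr even_graded
    even_skew even_jacobi.

End EvenPart.

Section Enveloping.
Variables (K : numFieldType) (g : lieSuperalgebra K).

Definition lie_map (B : algType K) (f : g -> B) : Prop :=
  linear f /\
  forall i j x y, x \in gpart g i -> y \in gpart g j ->
    f (bracket x y) = f x * f y - (-1) ^+ (i && j) *: (f y * f x).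

Inductive uterm : Type :=
  | UGen of g
  | UOne
  | UMul of uterm & uterm
  | UZero
  | UAdd of uterm & uterm
  | UScale of K & uterm.

Inductive ueq : uterm -> uterm -> Prop :=
  | ueq_refl s : ueq s s
  | ueq_sym s t : ueq s t -> ueq t s
  | ueq_trans s t u : ueq s t -> ueq t u -> ueq s u
  | ueq_mul s s' t t' : ueq s s' -> ueq t t' -> ueq (UMul s t) (UMul s' t')
  | ueq_add s s' t t' : ueq s s' -> ueq t t' -> ueq (UAdd s t) (UAdd s' t')
  | ueq_scale c s s' : ueq s s' -> ueq (UScale c s) (UScale c s')
  | ueq_addA s t u : ueq (UAdd s (UAdd t u)) (UAdd (UAdd s t) u)
  | ueq_addC s t : ueq (UAdd s t) (UAdd t s)
  | ueq_add0 s : ueq (UAdd UZero s) s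
  | ueq_addN s : ueq (UAdd (UScale (-1) s) s) UZero
  | ueq_scaleA c d s : ueq (UScale c (UScale d s)) (UScale (c * d) s)
  | ueq_scale1 s : ueq (UScale 1 s) s
  | ueq_scaleDr c s t : ueq (UScale c (UAdd s t)) (UAdd (UScale c s) (UScale c t))
  | ueq_scaleDl s c d : ueq (UScale (c + d) s) (UAdd (UScale c s) (UScale d s))
  | ueq_mulA s t u : ueq (UMul s (UMul t u)) (UMul (UMul s t) u)
  | ueq_mul1l s : ueq (UMul UOne s) s
  | ueq_mul1r s : ueq (UMul s UOne) s
  | ueq_mulDl s t u : ueq (UMul (UAdd s t) u) (UAdd (UMul s u) (UMul t u))
  | ueq_mulDr s t u : ueq (UMul s (UAdd t u)) (UAdd (UMul s t) (UMul s u))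
  | ueq_scaleAl c s t : ueq (UScale c (UMul s t)) (UMul (UScale c s) t)
  | ueq_scaleAr c s t : ueq (UScale c (UMul s t)) (UMul s (UScale c t))
  | ueq_lin c x y : ueq (UGen (c *: x + y)) (UAdd (UScale c (UGen x)) (UGen y))
  | ueq_bracket i j x y : x \in gpart g i -> y \in gpart g j ->
      ueq (UGen (bracket x y))
          (UAdd (UMul (UGen x) (UGen y))
                (UScale (- (-1) ^+ (i && j)) (UMul (UGen y) (UGen x)))).

HB.instance Definition _ := gen_eqMixin uterm.
HB.instance Definition _ := gen_choiceMixin uterm.

Definition ueqb (s t : uterm) : bool := `[< ueq s t >].

Lemma ueqb_refl : reflexive ueqb.
Proof. by move=> s; apply/asboolP; exact: ueq_refl. Qed.
Lemma ueqb_sym : symmetric ueqb.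
Proof. by move=> s t; apply/asboolP/asboolP; exact: ueq_sym. Qed.
Lemma ueqb_trans : transitive ueqb.
Proof.
by move=> t s u /asboolP st /asboolP tu; apply/asboolP; exact: ueq_trans st tu.
Qed.

Canonical ueq_equiv := EquivRel ueqb ueqb_refl ueqb_sym ueqb_trans.

(* The enveloping algebra, by generators (the elements of g) and relations. *)
Definition uea := {eq_quot ueq_equiv}.
HB.instance Definition _ := Choice.on uea.

Definition ucls (s : uterm) : uea := \pi_uea s.
Definition iota (x : g) : uea := ucls (UGen x).

Lemma uclsP s t : ueq s t -> ucls s = ucls t.
Proof. by move=> st; apply/eqmodP; apply/asboolP. Qed.
Lemma ucls_inj s t : ucls s = ucls t -> ueq s t.
Proof. by move/eqmodP/asboolP. Qed.
Lemma uclsK x : ucls (repr x) = x.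
Proof. exact: reprK. Qed.

Definition uadd (x y : uea) := ucls (UAdd (repr x) (repr y)).
Definition umul (x y : uea) := ucls (UMul (repr x) (repr y)).
Definition uscale c (x : uea) := ucls (UScale c (repr x)).
Definition uopp (x : uea) := uscale (-1) x.

Lemma ucls_add s t : ucls (UAdd s t) = uadd (ucls s) (ucls t).
Proof. by apply: uclsP; apply: ueq_add; apply: ucls_inj; rewrite uclsK. Qed.
Lemma ucls_mul s t : ucls (UMul s t) = umul (ucls s) (ucls t).
Proof. by apply: uclsP; apply: ueq_mul; apply: ucls_inj; rewrite uclsK. Qed.
Lemma ucls_scale c s : ucls (UScale c s) = uscale c (ucls s).
Proof. by apply: uclsP; apply: ueq_scale; apply: ucls_inj; rewrite uclsK. Qed.

Definition uclsE := (ucls_add, ucls_mul, ucls_scale).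

Lemma uaddA : associative uadd.
Proof.
move=> x y z; rewrite -[x]uclsK -[y]uclsK -[z]uclsK -!uclsE.
exact/uclsP/ueq_addA.
Qed.
Lemma uaddC : commutative uadd.
Proof.
by move=> x y; rewrite -[x]uclsK -[y]uclsK -!uclsE; apply/uclsP/ueq_addC.
Qed.
Lemma uadd0 : left_id (ucls UZero) uadd.
Proof. by move=> x; rewrite -[x]uclsK -uclsE; apply/uclsP/ueq_add0. Qed.
Lemma uaddN : left_inverse (ucls UZero) uopp uadd.
Proof. by move=> x; rewrite /uopp -[x]uclsK -!uclsE; apply/uclsP/ueq_addN. Qed.

HB.instance Definition _ := GRing.isZmodule.Build uea uaddA uaddC uadd0 uaddN.

Section Interp.
Variables (B : algType K) (f : g -> B).

Fixpoint uinterp (s : uterm) : B :=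
  match s with
  | UGen x => f x
  | UOne => 1
  | UMul s t => uinterp s * uinterp t
  | UZero => 0
  | UAdd s t => uinterp s + uinterp t
  | UScale c s => c *: uinterp s
  end.

Lemma uinterpP : lie_map f -> forall s t, ueq s t -> uinterp s = uinterp t.
Proof.
move=> [fl fb] s t; elim=> //=.
- by move=> ? ? ? _ -> _ ->.
- by move=> ? ? ? ? _ -> _ ->.
- by move=> ? ? ? ? _ -> _ ->.
- by move=> ? ? ? _ ->.
- by move=> *; rewrite addrA.
- by move=> *; rewrite addrC.
- by move=> *; rewrite add0r.
- by move=> *; rewrite scaleN1r addNr.
- by move=> *; rewrite scalerA.
- by move=> *; rewrite scale1r.
- by move=> *; rewrite scalerDr.
- by move=> *; rewrite scalerDl.
- by move=> *; rewrite mulrA.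
- by move=> *; rewrite mul1r.
- by move=> *; rewrite mulr1.
- by move=> *; rewrite mulrDl.
- by move=> *; rewrite mulrDr.
- by move=> *; rewrite scalerAl.
- by move=> *; rewrite scalerAr.
- by move=> i j x y xi yj; rewrite scaleNr; apply: fb.
Qed.

(* The algebra morphism induced by f; meaningful when f is a lie_map. *)
Definition ulift (x : uea) : B := uinterp (repr x).
End Interp.

Lemma lie_map0 : lie_map (fun _ => 0 : K^o).
Proof.
split=> [c x y|i j x y _ _]; first by rewrite scaler0 addr0.
by rewrite mul0r scaler0 subr0.
Qed.

Lemma umulA : associative umul.
Proof.
move=> x y z; rewrite -[x]uclsK -[y]uclsK -[z]uclsK -!uclsE.
exact/uclsP/ueq_mulA.
Qed.
Lemma umul1l : left_id (ucls UOne) umul.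
Proof. by move=> x; rewrite -[x]uclsK -uclsE; apply/uclsP/ueq_mul1l. Qed.
Lemma umul1r : right_id (ucls UOne) umul.
Proof. by move=> x; rewrite -[x]uclsK -uclsE; apply/uclsP/ueq_mul1r. Qed.
Lemma umulDl : left_distributive umul (@GRing.add uea).
Proof.
move=> x y z; rewrite -[x]uclsK -[y]uclsK -[z]uclsK -[_ + _]ucls_add -!uclsE.
by rewrite -[RHS]ucls_add; apply/uclsP/ueq_mulDl.
Qed.
Lemma umulDr : right_distributive umul (@GRing.add uea).
Proof.
move=> x y z; rewrite -[x]uclsK -[y]uclsK -[z]uclsK -[_ + _]ucls_add -!uclsE.
by rewrite -[RHS]ucls_add; apply/uclsP/ueq_mulDr.
Qed.
Lemma uone_neq0 : ucls UOne != 0.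
Proof.
apply/eqP => /ucls_inj /(uinterpP lie_map0) /= /eqP.
by rewrite oner_eq0.
Qed.

HB.instance Definition _ := GRing.Zmodule_isNzRing.Build uea
  umulA umul1l umul1r umulDl umulDr uone_neq0.

Lemma uscaleA c d (x : uea) : uscale c (uscale d x) = uscale (c * d) x.
Proof. by rewrite -[x]uclsK -!uclsE; apply/uclsP/ueq_scaleA. Qed.
Lemma uscale1 : left_id 1 uscale.
Proof. by move=> x; rewrite -[x]uclsK -!uclsE; apply/uclsP/ueq_scale1. Qed.
Lemma uscaleDr : right_distributive uscale (@GRing.add uea).
Proof.
move=> c x y; rewrite -[x]uclsK -[y]uclsK -[_ + _]ucls_add -!uclsE.
by rewrite -[RHS]ucls_add; apply/uclsP/ueq_scaleDr.
Qed.
Lemma uscaleDl (x : uea) : {morph uscale^~ x : c d / c + d >-> (c + d : uea)}.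
Proof.
move=> c d; rewrite -[x]uclsK -!uclsE -[RHS]ucls_add.
exact/uclsP/ueq_scaleDl.
Qed.

HB.instance Definition _ := GRing.Zmodule_isLmodule.Build K uea
  uscaleA uscale1 uscaleDr uscaleDl.

Lemma uscaleAl c (x y : uea) : c *: (x * y) = (c *: x) * y.
Proof.
rewrite -[x]uclsK -[y]uclsK -[_ * _ in LHS]ucls_mul -[c *: _ in LHS]ucls_scale.
rewrite -[c *: _]ucls_scale -[_ * _]ucls_mul; exact/uclsP/ueq_scaleAl.
Qed.
Lemma uscaleAr c (x y : uea) : c *: (x * y) = x * (c *: y).
Proof.
rewrite -[x]uclsK -[y]uclsK -[_ * _ in LHS]ucls_mul -[c *: _ in LHS]ucls_scale.
rewrite -[c *: _]ucls_scale -[_ * _]ucls_mul; exact/uclsP/ueq_scaleAr.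
Qed.

HB.instance Definition _ := GRing.Lmodule_isLalgebra.Build K uea uscaleAl.
HB.instance Definition _ := GRing.Lalgebra_isAlgebra.Build K uea uscaleAr.

Lemma uea_ind (P : uea -> Prop) :
  (forall x, P (iota x)) -> P 1 -> (forall u v, P u -> P v -> P (u * v)) ->
  (forall c u v, P u -> P v -> P (c *: u + v)) -> forall u, P u.
Proof.
move=> Pg P1 Pm Pl.
have P0 : P 0 by have := Pl (-1) _ _ P1 P1; rewrite scaleN1r addNr.
move=> u; rewrite -[u]uclsK.
elim: (repr u) => [x||s Ps t Pt||s Ps t Pt|c s Ps]; [exact: Pg|exact: P1|idtac|exact: P0|idtac|idtac].
- by rewrite ucls_mul; apply: Pm.
- by rewrite ucls_add -[ucls s]scale1r; apply: Pl.
- by have := Pl c _ _ Ps P0; rewrite addr0 ucls_scale.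
Qed.

Lemma iota_lie_map : lie_map iota.
Proof.
split=> [c x y|i j x y xi yj].
  by rewrite [LHS](uclsP (ueq_lin c x y)) !uclsE.
by rewrite [LHS](uclsP (ueq_bracket xi yj)) !uclsE -scaleNr.
Qed.

Section Universal.
Variables (B : algType K) (f : g -> B).
Hypothesis fL : lie_map f.

Lemma ulift_cls s : ulift f (ucls s) = uinterp f s.
Proof. by apply: (uinterpP fL); apply: ucls_inj; rewrite uclsK. Qed.

Lemma ulift_iota x : ulift f (iota x) = f x.
Proof. exact: ulift_cls. Qed.
Lemma ulift1 : ulift f 1 = 1.
Proof. exact: ulift_cls. Qed.
Lemma uliftM x y : ulift f (x * y) = ulift f x * ulift f y.
Proof.
by rewrite -[x in LHS]uclsK -[y in LHS]uclsK -[_ * _]ucls_mul ulift_cls.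
Qed.
Lemma ulift_linear : linear (ulift f).
Proof.
move=> c x y; rewrite -[x in LHS]uclsK -[y in LHS]uclsK.
by rewrite -[c *: _]ucls_scale -[_ + _]ucls_add ulift_cls.
Qed.
Lemma ulift_unique (h : uea -> B) : linear h -> h 1 = 1 ->
  (forall x y, h (x * y) = h x * h y) -> (forall x, h (iota x) = f x) ->
  h =1 ulift f.
Proof.
move=> hl h1 hM hi; apply: uea_ind => [x||u v eu ev|c u v eu ev].
- by rewrite hi ulift_iota.
- by rewrite h1 ulift1.
- by rewrite hM uliftM eu ev.
- by rewrite hl ulift_linear eu ev.
Qed.
End Universal.

End Enveloping.

Section Hopf.
Variables (K : numFieldType) (g : lieSuperalgebra K).
Local Notation U := (uea g).

Definition gcomp (i : bool) (x : g) : g := daddv_pi (gpart g i) (gpart g (~~ i)) x.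
Definition gparity (x : g) : g := gcomp false x - gcomp true x.

(* The automorphism of U acting by (-1)^[x]; the homogeneous components of U
   are its eigenspaces. *)
Definition uparity : U -> U := ulift (fun x => iota (gparity x)).
Definition ucomp (i : bool) (u : U) : U :=
  2^-1 *: (u + (-1) ^+ i *: uparity u).
Definition uhom (i : bool) (u : U) : Prop := ucomp i u = u.

Lemma gcomp_id i j x : x \in gpart g i -> gcomp j x = if i == j then x else 0.
Proof.
have cap k : (gpart g k :&: gpart g (~~ k) = 0)%VS.
  by case: k; rewrite /= ?(gpart_direct g) // capvC gpart_direct.
have full k : (gpart g k + gpart g (~~ k) = fullv)%VS.
  by case: k; rewrite /= ?(gpart_full g) // addvC gpart_full.
have id k y : y \in gpart g k -> gcomp k y = y by exact: daddv_pi_id.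
move=> xi; case: eqP => [<-|/eqP]; first exact: id.
rewrite eq_sym => /negPf ji.
have -> : j = ~~ i by case: i j ji {xi} => [] [].
have := daddv_pi_add (cap i) (_ : x \in gpart g i + gpart g (~~ i))%VS.
rewrite full memvf => /(_ isT); have := id i x xi; rewrite /gcomp negbK => ->.
by rewrite -[RHS]addr0 => /addrI.
Qed.

Lemma gparity_hom i x : x \in gpart g i -> gparity x = (-1) ^+ i *: x.
Proof.
move=> xi; rewrite /gparity !(gcomp_id _ xi).
by case: i xi => _ /=; rewrite ?sub0r ?subr0 ?scaleN1r ?scale1r.
Qed.

Lemma gparity_linear : linear gparity.
Proof.
by move=> c x y; rewrite /gparity /gcomp !linearP /= scalerDr addrACA.
Qed.

Lemma uparity_lie_map : lie_map (fun x => iota (gparity x)).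
Proof.
have [il ib] := iota_lie_map g; split=> [c x y|i j x y xi yj].
  by rewrite gparity_linear il.
have ii c x' : iota (c *: x') = c *: iota x' :> U.
  exact: lin_Z.
rewrite (gparity_hom (bracket_graded xi yj)) (gparity_hom xi) (gparity_hom yj).
rewrite !ii (ib _ _ _ _ xi yj); case: i j {xi yj} => [] [] /=;
by rewrite ?expr0 ?expr1 ?scale1r ?scaleN1r ?mulNr ?mulrN ?opprK ?opprB 1?addrC.
Qed.

Lemma uparity_linear : linear uparity.
Proof. exact: ulift_linear uparity_lie_map. Qed.
Lemma uparityM x y : uparity (x * y) = uparity x * uparity y.
Proof. exact: uliftM uparity_lie_map _ _. Qed.
Lemma uparity1 : uparity 1 = 1.
Proof. exact: ulift1 uparity_lie_map. Qed.
Lemma uparity_iota i x : x \in gpart g i ->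
  uparity (iota x) = (-1) ^+ i *: iota x.
Proof.
move=> xi; rewrite [LHS](ulift_iota uparity_lie_map) (gparity_hom xi).
have [il _] := iota_lie_map g.
exact: lin_Z.
Qed.

HB.instance Definition _ := GRing.isLinear.Build K U U _ uparity uparity_linear.

Lemma iotaD x y : iota (x + y) = iota x + iota y :> U.
Proof. by have [il _] := iota_lie_map g; have := il 1 x y; rewrite !scale1r. Qed.

Lemma uparityK : involutive uparity.
Proof.
move=> u; elim/uea_ind: u => [x||u v eu ev|c u v eu ev].
- have : x \in (gpart g false + gpart g true)%VS by rewrite gpart_full memvf.
  case/memv_addP => y y0 [z z1 ->].
  rewrite iotaD !linearD /= (uparity_iota y0) (uparity_iota z1) !linearZ /=.
  by rewrite (uparity_iota y0) (uparity_iota z1) !scalerA -!expr2 !sqrr_sign !scale1r.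
- by rewrite !uparity1.
- by rewrite !uparityM eu ev.
- by rewrite !linearP /= eu ev.
Qed.

Lemma ucomp_linear i : linear (ucomp i).
Proof.
move=> c u v; rewrite /ucomp linearP /= !scalerDr !scalerA addrACA.
by rewrite -!mulrA ![c * _]mulrC -!mulrA.
Qed.
HB.instance Definition _ i :=
  GRing.isLinear.Build K U U _ (ucomp i) (ucomp_linear i).

Lemma ucompD u : ucomp false u + ucomp true u = u.
Proof.
rewrite /ucomp expr0 expr1 scale1r scaleN1r -scalerDr addrACA subrr addr0.
by rewrite -mulr2n -scaler_nat scalerA mulVf ?scale1r // pnatr_eq0.
Qed.

Lemma uparity_ucomp i u : uparity (ucomp i u) = (-1) ^+ i *: ucomp i u.
Proof.
rewrite /ucomp linearZ /= linearD linearZ /= uparityK [in RHS]scalerA.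
rewrite mulrC -[in RHS]scalerA; congr (_ *: _).
by rewrite scalerDr scalerA -expr2 sqrr_sign scale1r addrC.
Qed.

Lemma uhomP i u : uhom i u <-> uparity u = (-1) ^+ i *: u.
Proof.
rewrite /uhom; split=> [e|e]; first by rewrite -[in LHS]e uparity_ucomp e.
rewrite /ucomp e scalerA -expr2 sqrr_sign scale1r -mulr2n -scaler_nat scalerA.
by rewrite mulVf ?scale1r // pnatr_eq0.
Qed.

Lemma ucomp_hom i u : uhom i (ucomp i u).
Proof. exact/uhomP/uparity_ucomp. Qed.

Lemma ucomp_id i j u : uhom i u -> ucomp j u = if i == j then u else 0.
Proof.
move=> ui; case: eqP => [<- //|/eqP ij].
have := ucompD u; move: ui; rewrite /uhom.
case: i j ij => [] [] // _ ->; first by rewrite -[RHS]add0r => /addIr.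
by rewrite -[RHS]addr0 => /addrI.
Qed.

Lemma uhomM i j u v : uhom i u -> uhom j v -> uhom (i (+) j) (u * v).
Proof.
move=> /uhomP ui /uhomP vj; apply/uhomP; rewrite uparityM ui vj.
by rewrite -scalerAl -scalerAr scalerA signr_addb.
Qed.

Lemma uhom1 : uhom false 1.
Proof. by apply/uhomP; rewrite uparity1 expr0 scale1r. Qed.

Lemma uhom_iota i x : x \in gpart g i -> uhom i (iota x).
Proof. by move=> xi; apply/uhomP/uparity_iota. Qed.

(* U (x) U as a superalgebra:
   (x (x) y)(x' (x) y') = (-1)^([y][x']) xx' (x) yy'. *)
Definition uea2 := tensor U U.
HB.instance Definition _ := GRing.Lmodule.on uea2.

Definition tmul_pure (x y x' y' : U) : uea2 :=
  \sum_(i : bool) \sum_(j : bool)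
    (-1) ^+ (i && j) *: tens (x * ucomp j x') (ucomp i y * y').
Definition tmul (s t : uea2) : uea2 :=
  tlift (fun x y => tlift (fun x' y' => tmul_pure x y x' y') t) s.

(* The same space with the opposite product (-1)^([x][y]) yx. *)
Definition uea_sop := U.
HB.instance Definition _ := GRing.Lmodule.on uea_sop.

Definition smul (x y : uea_sop) : uea_sop :=
  \sum_(i : bool) \sum_(j : bool)
    (-1) ^+ (i && j) *: ((ucomp j y : U) * (ucomp i x : U)).

Section LinearMaps.
Variables V W X : lmodType K.

Lemma lin_sum (f : bool -> V -> W) :
  (forall i, linear (f i)) -> linear (fun x => \sum_(i : bool) f i x).
Proof.
move=> fl c x y; rewrite scaler_sumr -big_split; apply: eq_bigr => i _ /=.
exact: fl.
Qed.
Lemma lin_scale a (f : V -> W) : linear f -> linear (fun x => a *: f x).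
Proof. by move=> fl c x y; rewrite fl scalerDr !scalerA mulrC. Qed.
Lemma lin_comp (f : W -> X) (h : V -> W) :
  linear f -> linear h -> linear (fun x => f (h x)).
Proof. by move=> fl hl c x y; rewrite hl fl. Qed.
Lemma lin_ucomp i : linear (ucomp i). Proof. exact: ucomp_linear. Qed.
Lemma lin_mull (a : U) : linear (fun x => a * x).
Proof. by move=> c x y; rewrite mulrDr scalerAr. Qed.
Lemma lin_mulr (a : U) : linear (fun x => x * a).
Proof. by move=> c x y; rewrite mulrDl scalerAl. Qed.
End LinearMaps.

Lemma lin_tlift (V W M N : lmodType K) (b : N -> V -> W -> M) s :
  (forall v w, linear (fun n => b n v w)) -> linear (fun n => tlift (b n) s).
Proof.
move=> bl c m n; rewrite /tlift.
elim: (repr s) => [v w||t IHt u IHu|d t IHt] /=.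
- exact: bl.
- by rewrite scaler0 addr0.
- by rewrite IHt IHu scalerDr addrACA.
- by rewrite IHt scalerDr !scalerA mulrC.
Qed.

Lemma tmul_pure_lin1 y x' y' : linear (fun x => tmul_pure x y x' y').
Proof.
apply: lin_sum => i; apply: lin_sum => j; apply: lin_scale.
exact: lin_comp (tens_linl _) (lin_mulr _).
Qed.
Lemma tmul_pure_lin2 x x' y' : linear (fun y => tmul_pure x y x' y').
Proof.
apply: lin_sum => i; apply: lin_sum => j; apply: lin_scale.
exact: lin_comp (tens_linr _) (lin_comp (lin_mulr _) (lin_ucomp _)).
Qed.
Lemma tmul_pure_lin3 x y y' : linear (fun x' => tmul_pure x y x' y').
Proof.
apply: lin_sum => i; apply: lin_sum => j; apply: lin_scale.
exact: lin_comp (tens_linl _) (lin_comp (lin_mull _) (lin_ucomp _)).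
Qed.
Lemma tmul_pure_lin4 x y x' : linear (fun y' => tmul_pure x y x' y').
Proof.
apply: lin_sum => i; apply: lin_sum => j; apply: lin_scale.
exact: lin_comp (tens_linr _) (lin_mull _).
Qed.

Lemma tmul_linl t : linear (tmul^~ t).
Proof.
by apply: tlift_linear => *; apply: lin_tlift => v w;
  [exact: tmul_pure_lin1|exact: tmul_pure_lin2].
Qed.
Lemma tmul_linr s : linear (tmul s).
Proof.
apply: lin_tlift => v w; apply: tlift_linear => *;
  [exact: tmul_pure_lin3|exact: tmul_pure_lin4].
Qed.

Lemma tmul_tens x y x' y' : tmul (tens x y) (tens x' y') = tmul_pure x y x' y'.
Proof.
rewrite /tmul tlift_tens => [|v w|v w]; last 2 first.
- by apply: lin_tlift => *; exact: tmul_pure_lin1.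
- by apply: lin_tlift => *; exact: tmul_pure_lin2.
by rewrite tlift_tens // => *; [exact: tmul_pure_lin3|exact: tmul_pure_lin4].
Qed.

Lemma tens0l (y : U) : tens (0 : U) y = 0 :> uea2.
Proof. exact: (lin_zero (tens_linl y)). Qed.
Lemma tens0r (x : U) : tens x (0 : U) = 0 :> uea2.
Proof. exact: (lin_zero (tens_linr x)). Qed.

Lemma tmul_hom i j x y x' y' : uhom i y -> uhom j x' ->
  tmul (tens x y) (tens x' y') = (-1) ^+ (i && j) *: tens (x * x') (y * y').
Proof.
move=> yi xj; rewrite tmul_tens /tmul_pure !big_bool /=.
rewrite !(ucomp_id _ yi) !(ucomp_id _ xj); case: i j {yi xj} => [] [] /=;
by rewrite ?(mul0r, mulr0, tens0l, tens0r, scaler0, addr0, add0r).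
Qed.

Lemma uea_hom_ind (P : U -> Prop) :
  (forall i u, uhom i u -> P u) -> (forall c u v, P u -> P v -> P (c *: u + v)) ->
  forall u, P u.
Proof.
move=> Ph Pl u; rewrite -[u]ucompD -[ucomp false u]scale1r.
by apply: Pl; apply: Ph (ucomp_hom _ _).
Qed.

Lemma uea2_hom_ind (P : uea2 -> Prop) :
  (forall i j u v, uhom i u -> uhom j v -> P (tens u v)) ->
  (forall c s t, P s -> P t -> P (c *: s + t)) -> forall s, P s.
Proof.
move=> Ph Pl; apply: (tens_ind (P := P)) => [u v|]; last exact: Pl.
elim/uea_hom_ind: u v => [i u ui v|c u u' Pu Pu' v]; last first.
  by rewrite tens_linl; apply: Pl.
elim/uea_hom_ind: v => [j v vj|c v v' Pv Pv']; first exact: Ph ui vj.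
by rewrite tens_linr; apply: Pl.
Qed.

Lemma tmulZl c s t : tmul (c *: s) t = c *: tmul s t.
Proof. exact: (lin_Z c s (tmul_linl t)). Qed.
Lemma tmulZr c s t : tmul s (c *: t) = c *: tmul s t.
Proof. exact: (lin_Z c t (tmul_linr s)). Qed.

Lemma tmulA : associative tmul.
Proof.
move=> s t u; elim/uea2_hom_ind: s => [i j a b ai bj|c s s' es es']; last first.
  by rewrite !(tmul_linl, es, es').
elim/uea2_hom_ind: t => [k l d e dk el|c t t' et et']; last first.
  by rewrite !(tmul_linl, tmul_linr, et, et').
elim/uea2_hom_ind: u => [m n f h fm hn|c u u' eu eu']; last first.
  by rewrite !(tmul_linl, tmul_linr, eu, eu').
rewrite (tmul_hom _ _ el fm) (tmul_hom _ _ bj dk) tmulZl tmulZr.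
rewrite (tmul_hom _ _ bj (uhomM dk fm)) (tmul_hom _ _ (uhomM bj el) fm).
rewrite !scalerA !mulrA; congr (_ *: _).
by case: j l k m {ai bj dk el fm hn} => [] [] [] [] /=;
  rewrite !(expr0, expr1, mulr1, mul1r, mulrNN).
Qed.

Lemma tmul1l : left_id (tens 1 1 : uea2) tmul.
Proof.
elim/uea2_hom_ind => [i j a b ai bj|c s t es et]; last first.
  by rewrite tmul_linr es et.
by rewrite (tmul_hom _ _ uhom1 ai) /= expr0 scale1r !mul1r.
Qed.
Lemma tmul1r : right_id (tens 1 1 : uea2) tmul.
Proof.
elim/uea2_hom_ind => [i j a b ai bj|c s t es et]; last first.
  by rewrite tmul_linl es et.
by rewrite (tmul_hom _ _ bj uhom1) andbF expr0 scale1r !mulr1.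
Qed.
Lemma tmulDl : left_distributive tmul (@GRing.add uea2).
Proof. by move=> s t u; have := tmul_linl u 1 s t; rewrite !scale1r. Qed.
Lemma tmulDr : right_distributive tmul (@GRing.add uea2).
Proof. by move=> s t u; have := tmul_linr s 1 t u; rewrite !scale1r. Qed.

Definition counit : U -> K := @ulift K g K^o (fun _ => 0).

Lemma tens11_neq0 : (tens 1 1 : uea2) != 0.
Proof.
pose b (x y : U) : K^o := counit x * counit y.
have cl : linear (counit : U -> K^o) := ulift_linear (lie_map0 g).
have bl w : linear (b^~ w) by move=> c x y; rewrite /b cl mulrDl scalerAl.
have br v : linear (b v) by move=> c x y; rewrite /b cl mulrDr scalerAr.
apply/eqP => e; have := tlift_tens bl br 1 1; rewrite e.
have -> : tlift b 0 = 0.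
  exact: (lin_zero (tlift_linear bl br)).
rewrite /b /counit (ulift1 (lie_map0 g)) mulr1 => /eqP.
by rewrite eq_sym oner_eq0.
Qed.

HB.instance Definition _ := GRing.Zmodule_isNzRing.Build uea2
  tmulA tmul1l tmul1r tmulDl tmulDr tens11_neq0.
HB.instance Definition _ := GRing.Lmodule_isLalgebra.Build K uea2
  (fun c s t => esym (tmulZl c s t)).
HB.instance Definition _ := GRing.Lalgebra_isAlgebra.Build K uea2
  (fun c s t => esym (tmulZr c s t)).

Lemma smul_linl y : linear (smul^~ y).
Proof.
apply: lin_sum => i; apply: lin_sum => j; apply: lin_scale.
exact: lin_comp (lin_mull _) (lin_ucomp _).
Qed.
Lemma smul_linr x : linear (smul x).
Proof.
apply: lin_sum => i; apply: lin_sum => j; apply: lin_scale.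
exact: lin_comp (lin_mulr _) (lin_ucomp _).
Qed.

Lemma smul_hom i j (x y : U) : uhom i x -> uhom j y ->
  smul x y = (-1) ^+ (i && j) *: (y * x).
Proof.
move=> xi yj; rewrite /smul !big_bool /=.
rewrite !(ucomp_id _ xi) !(ucomp_id _ yj); case: i j {xi yj} => [] [] /=;
by rewrite ?(mul0r, mulr0, scaler0, addr0, add0r).
Qed.

Lemma smulZl c s t : smul (c *: s) t = c *: smul s t.
Proof. exact: (lin_Z c s (smul_linl t)). Qed.
Lemma smulZr c s t : smul s (c *: t) = c *: smul s t.
Proof. exact: (lin_Z c t (smul_linr s)). Qed.

Lemma smulA : associative smul.
Proof.
move=> x y z; elim/uea_hom_ind: x => [i x xi|c s s' es es']; last first.
  by rewrite !(smul_linl, es, es').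
elim/uea_hom_ind: y => [j y yj|c t t' et et']; last first.
  by rewrite !(smul_linl, smul_linr, et, et').
elim/uea_hom_ind: z => [k z zk|c u u' eu eu']; last first.
  by rewrite !(smul_linl, smul_linr, eu, eu').
rewrite (smul_hom yj zk) (smul_hom xi yj) smulZl smulZr.
rewrite (smul_hom xi (uhomM zk yj)) (smul_hom (uhomM yj xi) zk).
rewrite !scalerA !mulrA; congr (_ *: _).
by case: i j k {xi yj zk} => [] [] [] /=;
  rewrite !(expr0, expr1, mulr1, mul1r, mulrNN).
Qed.

Lemma smul1l : left_id (1 : U) smul.
Proof.
elim/uea_hom_ind => [i x xi|c s t es et]; last by rewrite smul_linr es et.
by rewrite (smul_hom uhom1 xi) /= expr0 scale1r mulr1.
Qed.
Lemma smul1r : right_id (1 : U) smul.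
Proof.
elim/uea_hom_ind => [i x xi|c s t es et]; last by rewrite smul_linl es et.
by rewrite (smul_hom xi uhom1) andbF expr0 scale1r mul1r.
Qed.
Lemma smulDl : left_distributive smul (@GRing.add uea_sop).
Proof. by move=> s t u; have := smul_linl u 1 s t; rewrite !scale1r. Qed.
Lemma smulDr : right_distributive smul (@GRing.add uea_sop).
Proof. by move=> s t u; have := smul_linr s 1 t u; rewrite !scale1r. Qed.

HB.instance Definition _ := GRing.Zmodule_isNzRing.Build uea_sop
  smulA smul1l smul1r smulDl smulDr (oner_neq0 U).
HB.instance Definition _ := GRing.Lmodule_isLalgebra.Build K uea_sop
  (fun c s t => esym (smulZl c s t)).
HB.instance Definition _ := GRing.Lalgebra_isAlgebra.Build K uea_sop
  (fun c s t => esym (smulZr c s t)).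

Definition coproduct : U -> uea2 := @ulift K g uea2
  (fun x => tens (iota x) 1 + tens 1 (iota x)).
Definition antipode : U -> U := @ulift K g uea_sop (fun x => - iota x).

Lemma antipode_lie_map : @lie_map K g uea_sop (fun x => - iota x).
Proof.
have [il ib] := iota_lie_map g; split=> [c x y|i j x y xi yj].
  by rewrite il opprD scalerN.
have xh := uhom_iota xi; have yh := uhom_iota yj.
have NN (a b : g) : (- iota a : uea_sop) * (- iota b : uea_sop)
                  = smul (iota a) (iota b) by rewrite mulrNN.
rewrite !NN (smul_hom xh yh) (smul_hom yh xh) (ib _ _ _ _ xi yj) andbC.
by rewrite scalerA -expr2 sqrr_sign scale1r opprB.
Qed.

Lemma coproduct_lie_map :
  @lie_map K g uea2 (fun x => tens (iota x) 1 + tens 1 (iota x)).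
Proof.
have [il ib] := iota_lie_map g; split=> [c x y|i j x y xi yj].
  by rewrite il tens_linl tens_linr scalerDr addrACA.
have xh := uhom_iota xi; have yh := uhom_iota yj.
have B (f : U -> uea2) c a b : linear f -> f (a - c *: b) = f a - c *: f b.
  by move=> fl; rewrite -scaleNr addrC fl scaleNr addrC.
have Z (a d e f b d' : uea2) :
    a + e + (f + d) - (b + f + (e + d')) = a - b + (d - d').
  have -> : a + e + (f + d) = a + d + (e + f) by rewrite [f + d]addrC addrACA.
  have -> : b + f + (e + d') = b + d' + (e + f).
    by rewrite [e + d']addrC addrACA [f + e]addrC.
  by rewrite opprD addrACA subrr addr0 opprD addrACA.
have E k l (a b : U) : uhom k a -> uhom l b ->
    (tens a 1 + tens 1 a : uea2) * (tens b 1 + tens 1 b) =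
    tens (a * b) 1 + tens a b + ((-1) ^+ (k && l) *: tens b a + tens 1 (a * b)).
  move=> ak bl; rewrite mulrDl !mulrDr.
  have T (p q r s : U) : (tens p q : uea2) * (tens r s : uea2) = tmul (tens p q) (tens r s) by [].
  rewrite !T (tmul_hom _ _ uhom1 bl) (tmul_hom _ _ uhom1 uhom1).
  rewrite (tmul_hom _ _ ak bl) (tmul_hom _ _ ak uhom1).
  by rewrite /= andbF !expr0 !scale1r !mulr1 !mul1r.
rewrite (E _ _ _ _ xh yh) (E _ _ _ _ yh xh) (ib _ _ _ _ xi yj).
rewrite (B _ _ _ _ (tens_linl 1)) (B _ _ _ _ (tens_linr 1)) [j && i]andbC.
by rewrite !scalerDr scalerA -expr2 sqrr_sign scale1r Z.
Qed.


End Hopf.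

Arguments ucomp {K g} i u.
Arguments counit {K g} u.

Section Dual.
Variables (K : numFieldType) (g : lieSuperalgebra K).
Local Notation U := (uea g).

(* Homogeneous components of a linear form: a form of degree j is one that
   vanishes on the component of U of the other degree. *)
Definition dcomp (j : bool) (a : U -> K) : U -> K := fun x => a (ucomp j x).

(* <f (x) h, x (x) y> = (-1)^([h][x]) <f, x> <h, y>, expanded into homogeneous
   components; the degree-j component of h sees only the component y_j. *)
Definition spair (X Y : Type) (cX : bool -> X -> X) (cY : bool -> Y -> Y)
    (f : X -> K) (h : Y -> K) (x : X) (y : Y) : K :=
  \sum_(i : bool) \sum_(j : bool) (-1) ^+ (i && j) * (f (cX i x) * h (cY j y)).

Definition dpair (a b : U -> K) : U -> U -> K := spair ucomp ucomp a b.

Definition dmul (a b : U -> K) : U -> K :=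
  fun x => tlift (dpair a b : U -> U -> K^o) (coproduct x).

Record graded_rep n (d : 'I_n -> bool) (rho : U -> 'M[K]_n) : Prop := {
  rep_linear : linear rho;
  rep_one : rho 1 = 1%:M;
  rep_mul : forall x y, rho (x * y) = rho x *m rho y;
  rep_graded : forall i x p q, uhom i x -> rho x p q != 0 -> d p = i (+) d q
}.

(* Matrix elements w.r.t. arbitrary vectors and covectors, i.e. the linear
   combinations of the coefficient functions x |-> rho x p q. *)
Definition finite_dual : set (U -> K) :=
  [set f | exists n (d : 'I_n -> bool) (rho : U -> 'M[K]_n),
    graded_rep d rho /\
    exists (u : 'rV[K]_n) (v : 'cV[K]_n),
      forall x, f x = (u *m rho x *m v) 0 0].

(* s lists tensors a'_k (x) a''_k in B (x) B with sum Delta(a); such an element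
   of B (x) B is unique, as B (x) B embeds into the bilinear forms on U. *)
Definition coprod_rep (B : set (U -> K)) (a : U -> K)
    (s : seq ((U -> K) * (U -> K))) : Prop :=
  (forall p, p \in s -> B p.1 /\ B p.2) /\
  forall x y, \sum_(p <- s) dpair p.1 p.2 x y = a (x * y).

Definition coprod (B : set (U -> K)) (a : U -> K) :
    seq ((U -> K) * (U -> K)) := xget [::] (coprod_rep B a).

Record sub_hopf (A : set (U -> K)) : Prop := {
  sub_finite_dual : A `<=` finite_dual;
  sub_linear : forall c a b, A a -> A b -> A (fun x => c * a x + b x);
  sub_graded : forall j a, A a -> A (dcomp j a);
  sub_one : A counit;
  sub_mul : forall a b, A a -> A b -> A (dmul a b);
  sub_coprod : forall a, A a -> exists s, coprod_rep A a s;
  sub_antipode : forall a, A a -> A (fun x => a (antipode x))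
}.

Definition linear_form_on (B : set (U -> K)) (I : (U -> K) -> K) : Prop :=
  forall c a b, B a -> B b -> I (fun x => c * a x + b x) = c * I a + I b.

(* (id (x) I)(a (x) b) = (-1)^([I][a]) a I(b). *)
Definition id_tensor (I : (U -> K) -> K) (a b : U -> K) : U -> K :=
  fun x => \sum_(i : bool) \sum_(j : bool)
    (-1) ^+ (i && j) * (dcomp i a x * I (dcomp j b)).

(* Linear forms on B are represented by functions on all of U -> K, only the
   values on B being relevant. *)
Definition left_integral (B : set (U -> K)) (I : (U -> K) -> K) : Prop :=
  linear_form_on B I /\
  forall a s, B a -> coprod_rep B a s ->
    forall x, \sum_(p <- s) id_tensor I p.1 p.2 x = counit x * I a.

(* <f . h, a> = <f (x) h, Delta(a)> for linear forms f, h on B. *)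
Definition form_mul (B : set (U -> K)) (f h : (U -> K) -> K) (a : U -> K) : K :=
  \sum_(p <- coprod B a) spair dcomp dcomp f h p.1 p.2.

(* nu(x)(a) = (-1)^([x][a]) <a, x>. *)
Definition nu (x : U) (a : U -> K) : K :=
  \sum_(i : bool) \sum_(j : bool) (-1) ^+ (i && j) * dcomp j a (ucomp i x).

Definition even_emb : uea (even_lie g) -> U :=
  ulift (fun x : even_lie g => iota (vsval x)).

Lemma even_emb_lie_map : lie_map (fun x : even_lie g => iota (vsval x) : U).
Proof.
have [il ib] := iota_lie_map g; split=> [c x y|i j x y xi yj].
  by rewrite linearP il.
by rewrite [bracket x y]/(even_bracket x y) even_bracketE;
  apply: ib; apply: even_gpartP.
Qed.

(* The map P; U(g_0) is the enveloping algebra of the Lie algebra g_0, mapped to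
   U(g) by even_emb. *)
Definition restr (a : U -> K) : uea (even_lie g) -> K :=
  fun u => a (even_emb u).

Definition ideal_J : set U :=
  [set u | exists s : seq (U * g),
    (forall p, p \in s -> p.2 \in gpart g false) /\
    u = \sum_(p <- s) p.1 * iota p.2].

Definition invariant_mod_J (z : U) : Prop :=
  forall x, ideal_J (x * z - counit x *: z).

(* Classes modulo J are handled through representatives in U: the classes of the
   homogeneous elements v i form a basis of U/J. *)
Record quotient_basis n (d : 'I_n -> bool) (v : 'I_n -> U) : Prop := {
  qb_hom : forall i, uhom (d i) (v i);
  qb_span : forall u, exists c : 'I_n -> K,
    ideal_J (u - \sum_(i < n) c i *: v i);
  qb_free : forall c : 'I_n -> K,
    ideal_J (\sum_(i < n) c i *: v i) -> forall i, c i = 0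
}.

(* x (v_j + J) = sum_i pi_ij(x) (v_i + J). *)
Definition quotient_matrix n (v : 'I_n -> U) (pi : 'I_n -> 'I_n -> U -> K) :
    Prop :=
  forall x j, ideal_J (x * v j - \sum_(i < n) pi i j x *: v i).

End Dual.

(* Main.v *)
Require Import Defs.
From mathcomp Require Import all_boot all_order all_algebra.
From mathcomp Require Import boolp classical_sets reals complex.

Set Implicit Arguments.
Unset Strict Implicit.
Unset Printing Implicit Defensive.
Import GRing.Theory Num.Theory.
Local Open Scope ring_scope.
Local Open Scope classical_set_scope.

Local Notation iota := (@Defs.iota _ _).

(** For a linear form I, applying id (x) I to Delta(a) and evaluating at x is
    the same as applying I to the translated form y |-> a (x * y): the sign of
    the super tensor product of forms is exactly the one in the pairing with
    x (x) y.  Hence, on a graded subcoalgebra B of the dual,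

    - I is a left integral iff I (a (x * _)) = counit x * I a;
    - (nu w . I) a = I (a (uparity w * _)), the parity automorphism being the
      effect of the sign in nu.

    Let I be I0 after restriction to U(g_0).  The first point for I0 says that I
    is invariant under translation by elements of U(g_0); so I kills
    a (x * w * _) whenever w lies in the augmentation ideal of U(g_0), that is,
    I (a (w * _)) only depends on w modulo J.  This gives the independence of
    the representative.  Translating nu z . I by x replaces uparity z by
    x * uparity z, which is counit x *: uparity z modulo J because z is
    invariant; so nu z . I is a left integral.

    For the last claim, let a_i be the i-th coordinate of the class modulo J; it
    is a combination of matrix elements of U/J, since x + J = x (1 + J).  As
    w * u = counit u *: w modulo J for u in U(g_0), restricting a_i (w * _) to
    U(g_0) gives a_i w times the counit, and so (nu z . I) a_i is
    a_i (uparity z), because I0 of the counit is 1.  If all of these vanish,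
    then uparity z is in J, and so is z. *)

(** * Translation of linear forms *)

Section Translation.
Variables (K : numFieldType) (g : lieSuperalgebra K).
Local Notation U := (uea g).
Implicit Types (B : set (U -> K)) (I : (U -> K) -> K) (a b : U -> K).

Definition left_translate (x : U) a : U -> K := fun y => a (x * y).

(** The part of [sub_hopf] shared by a Hopf subalgebra of the finite dual and by
    its restriction to the even part. *)
Record graded_subcoalgebra B : Prop := {
  subc_lin : forall a, B a -> linear (a : U -> K^o);
  subc_zero : B (fun=> 0);
  subc_linear : forall c a b, B a -> B b -> B (fun x => c * a x + b x);
  subc_graded : forall j a, B a -> B (dcomp j a);
  subc_coprod : forall a, B a -> exists s, coprod_rep B a s
}.

Lemma finite_dual_lin a : finite_dual a -> linear (a : U -> K^o).
Proof.
move=> [n [d [rho [[rl _ _ _] [u [v e]]]]]] c x y.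
by rewrite !e rl mulmxDr mulmxDl -scalemxAr -scalemxAl !mxE.
Qed.

Lemma sub_hopf_subcoalgebra B : sub_hopf B -> graded_subcoalgebra B.
Proof.
move=> HB; split.
- by move=> a /(sub_finite_dual HB)/finite_dual_lin.
- have -> : (fun=> 0) = (fun x : U => -1 * counit x + counit x) :> (U -> K).
    by apply/funext => x; rewrite mulN1r addNr.
  by apply: (sub_linear HB); apply: (sub_one HB).
- exact: sub_linear.
- exact: sub_graded.
- exact: sub_coprod.
Qed.

Section Subcoalgebra.
Variables (B : set (U -> K)) (I : (U -> K) -> K).
Hypotheses (HB : graded_subcoalgebra B) (HI : linear_form_on B I).

Lemma linear_form_on0 : I (fun=> 0) = 0.
Proof.
have B0 := subc_zero HB; have := @HI (-1) _ _ B0 B0.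
rewrite (mulN1r (I _)) addNr => e; rewrite -[RHS]e; congr I.
by apply/funext => x; rewrite mulr0 addr0.
Qed.

Lemma linear_form_on_sum (T : eqType) (s : seq T) (c : T -> K)
    (F : T -> U -> K) :
  (forall p, p \in s -> B (F p)) ->
  B (fun y => \sum_(p <- s) c p * F p y) /\
  I (fun y => \sum_(p <- s) c p * F p y) = \sum_(p <- s) c p * I (F p).
Proof.
elim: s => [_|p s IHs BF].
  have -> : (fun y => \sum_(p <- [::]) c p * F p y) = (fun=> 0).
    by apply/funext => y; rewrite big_nil.
  by rewrite big_nil linear_form_on0; split=> //; exact: (subc_zero HB).
have [Bs Is] : B (fun y => \sum_(p <- s) c p * F p y) /\
    I (fun y => \sum_(p <- s) c p * F p y) = \sum_(p <- s) c p * I (F p).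
  by apply: IHs => q qs; apply: BF; rewrite inE qs orbT.
have Bp : B (F p) by apply: BF; rewrite mem_head.
have -> : (fun y => \sum_(q <- p :: s) c q * F q y) =
          (fun y => c p * F p y + \sum_(q <- s) c q * F q y).
  by apply/funext => y; rewrite big_cons.
by rewrite big_cons HI // Is; split=> //; apply: (subc_linear HB).
Qed.

(** The pairing of p.1 (x) p.2 with x (x) y and the value at x of
    (id (x) I)(p.1 (x) p.2) carry the same sign, so both are computed by the
    same expansion of p.2 into homogeneous components. *)
Lemma id_tensor_coprod a s x : coprod_rep B a s ->
  B (left_translate x a) /\
  \sum_(p <- s) id_tensor I p.1 p.2 x = I (left_translate x a).
Proof.
move=> [Bs sa].
pose c j (p : (U -> K) * (U -> K)) :=
  \sum_(i : bool) (-1) ^+ (i && j) * p.1 (ucomp i x).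
pose G j y := \sum_(p <- s) c j p * dcomp j p.2 y.
have BG j : B (G j) /\ I (G j) = \sum_(p <- s) c j p * I (dcomp j p.2).
  apply: (linear_form_on_sum (c j) (F := fun p => dcomp j p.2)) => p /Bs[_].
  exact: (subc_graded HB).
(* The coefficient 1 matches the form c * a + b of the linearity axioms. *)
have -> : left_translate x a = (fun y => 1 * G false y + G true y).
  apply/funext => y; rewrite /left_translate -sa mul1r -big_split /=.
  apply: eq_bigr => p _; rewrite /dpair /spair exchange_big big_bool addrC /=.
  by rewrite /c !mulr_suml; congr (_ + _); apply: eq_bigr => i _; rewrite mulrA.
have [[B0 I0] [B1 I1]] := (BG false, BG true).
split; first exact: (subc_linear HB).
rewrite HI // I0 I1 mul1r -big_split /=; apply: eq_bigr => p _.
rewrite /id_tensor exchange_big big_bool addrC /=.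
by rewrite /c !mulr_suml; congr (_ + _); apply: eq_bigr => i _; rewrite mulrA.
Qed.

(** The defining identity of a left integral, evaluated at x. *)
Lemma left_integralP : left_integral B I <->
  forall a x, B a -> I (left_translate x a) = counit x * I a.
Proof.
split=> [[_ int] a x Ba|inv].
  have [s sa] := subc_coprod HB Ba.
  by rewrite -(int a s) //; have [_ ->] := id_tensor_coprod x sa.
split=> // a s Ba sa x.
by rewrite -inv //; have [_ ->] := id_tensor_coprod x sa.
Qed.

(** The sign (-1)^([w][a]) of nu amounts to applying the parity automorphism to
    w, since a linear form a pairs only with elements of its own degree. *)
Lemma nu_dcomp i a w : linear (a : U -> K^o) ->
  nu w (dcomp i a) = dcomp i a (uparity w).
Proof.
move=> al.
have a0 : a 0 = 0 := lin_zero al.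
have h j k u : ucomp j (ucomp k u) = if k == j then ucomp k u else 0.
  exact: ucomp_id (ucomp_hom k u).
have e : ucomp i (uparity w) = (-1) ^+ i *: ucomp i w.
  rewrite -uparity_ucomp /ucomp [RHS]linearZ; congr (_ *: _).
  by rewrite [RHS]linearD /=; congr (_ + _); rewrite [RHS]linearZ.
have aZ c u : a (c *: u) = c * a u := lin_Z c u al.
have u0 j : ucomp j (0 : U) = 0 by exact: linear0.
rewrite /dcomp e aZ /nu /dcomp !big_bool /=.
by case: i {e} => /=; rewrite !h /= ?h ?u0 /= a0
  !(expr0, expr1, mulr0, mulN1r, mul1r, addr0, add0r, oppr0).
Qed.

Lemma form_mul_nu w a : B a ->
  form_mul B (nu w) I a = I (left_translate (uparity w) a).
Proof.
move=> Ba; have sa : coprod_rep B a (coprod B a).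
  exact: xgetPex (subc_coprod HB Ba).
have [_ <-] := id_tensor_coprod (uparity w) sa.
rewrite /form_mul; apply: eq_big_seq => p ps.
have [Bp _] := sa.1 p ps.
rewrite /spair /id_tensor; apply: eq_bigr => i _; apply: eq_bigr => j _.
by rewrite nu_dcomp //; apply: (subc_lin HB).
Qed.

End Subcoalgebra.

Lemma left_translate_closed B x a : graded_subcoalgebra B -> B a ->
  B (left_translate x a).
Proof.
move=> HB /(subc_coprod HB)[s sa].
have H0 : linear_form_on B (fun=> 0) by move=> *; rewrite mulr0 addr0.
by have [] := id_tensor_coprod HB H0 x sa.
Qed.

End Translation.

(** * The left ideal generated by the even part *)

Section IdealJ.
Variables (K : numFieldType) (g : lieSuperalgebra K).
Local Notation U := (uea g).

Lemma ideal_J0 : ideal_J (0 : U).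
Proof. by exists [::]; rewrite big_nil. Qed.

Lemma ideal_J_lin c (u v : U) : ideal_J u -> ideal_J v -> ideal_J (c *: u + v).
Proof.
move=> [s [s0 ->]] [t [t0 ->]].
exists ([seq (c *: p.1, p.2) | p <- s] ++ t); split.
  move=> p; rewrite mem_cat => /orP[/mapP[q qs ->]|]; [exact: (s0 q)|exact: t0].
rewrite big_cat big_map /= scaler_sumr; congr (_ + _).
by apply: eq_bigr => p _; rewrite scalerAl.
Qed.

Lemma ideal_JD (u v : U) : ideal_J u -> ideal_J v -> ideal_J (u + v).
Proof. by move=> Ju Jv; rewrite -[u]scale1r; apply: ideal_J_lin. Qed.

Lemma ideal_JZ c (u : U) : ideal_J u -> ideal_J (c *: u).
Proof. by move=> Ju; rewrite -[_ *: _]addr0; apply: ideal_J_lin ideal_J0. Qed.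

Lemma ideal_JB (u v : U) : ideal_J u -> ideal_J v -> ideal_J (u - v).
Proof. by move=> Ju Jv; rewrite addrC -scaleN1r; apply: ideal_J_lin. Qed.

Lemma ideal_J_sum n (F : 'I_n -> U) :
  (forall i, ideal_J (F i)) -> ideal_J (\sum_i F i).
Proof.
by move=> JF; apply: big_ind => //; [exact: ideal_J0|exact: ideal_JD].
Qed.

Lemma ideal_J_mull w (u : U) : ideal_J u -> ideal_J (w * u).
Proof.
move=> [s [s0 ->]]; exists [seq (w * p.1, p.2) | p <- s]; split.
  by move=> p /mapP[q qs ->]; exact: (s0 q).
by rewrite big_map mulr_sumr; apply: eq_bigr => p _; rewrite mulrA.
Qed.

Lemma ideal_J_uparity (u : U) : ideal_J u -> ideal_J (uparity u).
Proof.
move=> [s [s0 ->]]; exists [seq (uparity p.1, p.2) | p <- s]; split.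
  by move=> p /mapP[q qs ->]; exact: (s0 q).
rewrite linear_sum big_map; apply: eq_big_seq => p ps /=.
by rewrite uparityM (uparity_iota (s0 p ps)) expr0 scale1r.
Qed.

Lemma counitM (x y : U) : counit (x * y) = counit x * counit y.
Proof. exact: (uliftM (lie_map0 g)). Qed.

Lemma counit_linear : linear (counit : U -> K^o).
Proof. exact: (ulift_linear (lie_map0 g)). Qed.

Lemma counit_uparity (x : U) : counit (uparity x) = counit x.
Proof.
elim/uea_ind: x => [x||u v eu ev|c u v eu ev].
- rewrite [uparity _](ulift_iota (uparity_lie_map g)).
  by rewrite /counit !(ulift_iota (lie_map0 g)).
- by rewrite uparity1.
- by rewrite uparityM !counitM eu ev.
- by rewrite linearP /= !counit_linear eu ev.
Qed.

(** Both J and the counit are stable under the parity automorphism. *)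
Lemma invariant_mod_J_uparity (z : U) :
  invariant_mod_J z -> invariant_mod_J (uparity z).
Proof.
move=> Hz x; have := ideal_J_uparity (Hz (uparity x)).
by rewrite linearB linearZ /= uparityM uparityK counit_uparity.
Qed.

End IdealJ.

(** * Restriction to the even part *)

Section Restriction.
Variables (K : numFieldType) (g : lieSuperalgebra K).
Local Notation U := (uea g).
Local Notation U0 := (uea (even_lie g)).

Lemma even_embM (x y : U0) : even_emb (x * y) = even_emb x * even_emb y.
Proof. exact: (uliftM (even_emb_lie_map g)). Qed.

Lemma even_emb1 : even_emb (1 : U0) = 1.
Proof. exact: (ulift1 (even_emb_lie_map g)). Qed.

Lemma even_emb_iota x : even_emb (iota x : U0) = iota (vsval x).
Proof. exact: (ulift_iota (even_emb_lie_map g)). Qed.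

Lemma even_emb_linear : linear (@even_emb K g).
Proof. exact: (ulift_linear (even_emb_lie_map g)). Qed.

Lemma even_emb_even (u : U0) : uhom false (even_emb u).
Proof.
elim/uea_ind: u => [x||u v eu ev|c u v eu ev].
- by rewrite even_emb_iota; apply/uhom_iota/subvsP.
- by rewrite even_emb1; apply: uhom1.
- by rewrite even_embM; apply: (uhomM eu ev).
- by move: eu ev; rewrite even_emb_linear /uhom linearP /= => -> ->.
Qed.

(** J absorbs the augmentation ideal of U(g_0), by
    u v - counit u counit v = counit v (u - counit u) + u (v - counit v). *)
Lemma even_emb_counit (u : U0) : ideal_J (even_emb u - (counit u)%:A).
Proof.
elim/uea_ind: u => [x||u v eu ev|c u v eu ev].
- rewrite even_emb_iota /counit (ulift_iota (lie_map0 _)) scale0r subr0.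
  exists [:: (1, vsval x)]; split; last by rewrite big_seq1 mul1r.
  by move=> p; rewrite inE => /eqP ->; apply: subvsP.
- rewrite even_emb1 /counit (ulift1 (lie_map0 _)) scale1r subrr.
  exact: ideal_J0.
- suff -> : even_emb (u * v) - (counit (u * v))%:A =
      counit v *: (even_emb u - (counit u)%:A) +
      even_emb u * (even_emb v - (counit v)%:A).
    by apply: ideal_J_lin => //; apply: ideal_J_mull.
  rewrite even_embM counitM mulrBr -scalerAr mulr1 scalerBr scalerA.
  by rewrite [counit v * _]mulrC [RHS]addrC addrA subrK.
- rewrite even_emb_linear counit_linear scalerDl -scalerA.
  by rewrite opprD addrACA -scalerBr; apply: ideal_J_lin.
Qed.

Lemma restr_counit : restr counit = counit :> (U0 -> K).
Proof.
apply/funext => u; rewrite /restr.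
elim/uea_ind: u => [x||u v eu ev|c u v eu ev].
- by rewrite even_emb_iota /counit !(ulift_iota (lie_map0 _)).
- by rewrite even_emb1 /counit !(ulift1 (lie_map0 _)).
- by rewrite even_embM !counitM eu ev.
- by rewrite even_emb_linear (counit_linear c (even_emb u)) eu ev counit_linear.
Qed.

Lemma even_lie_even (u : U0) : uhom false u.
Proof.
elim/uea_ind: u => [x||u v eu ev|c u v eu ev].
- by apply: uhom_iota; rewrite /= memvf.
- exact: uhom1.
- exact: (uhomM eu ev).
- by move: eu ev; rewrite /uhom linearP /= => -> ->.
Qed.

Lemma even_emb_ucomp j (u : U0) : even_emb (ucomp j u) = ucomp j (even_emb u).
Proof.
rewrite (ucomp_id _ (even_lie_even u)) (ucomp_id _ (even_emb_even u)).
by case: j => //=; apply: (lin_zero even_emb_linear).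
Qed.

Lemma dpair_restr (a b : U -> K) (x y : U0) :
  dpair (restr a) (restr b) x y = dpair a b (even_emb x) (even_emb y).
Proof.
rewrite /dpair /spair; apply: eq_bigr => i _; apply: eq_bigr => j _.
by rewrite /restr !even_emb_ucomp.
Qed.

Lemma restr_subcoalgebra (A : set (U -> K)) : graded_subcoalgebra A ->
  graded_subcoalgebra [set restr a | a in A].
Proof.
move=> HA; split.
- move=> _ [a Aa <-] c x y; rewrite /restr even_emb_linear.
  exact: (subc_lin HA Aa).
- by exists (fun=> 0) => //; apply: (subc_zero HA).
- move=> c _ _ [a Aa <-] [b Ab <-].
  by exists (fun x => c * a x + b x) => //; apply: (subc_linear HA).
- move=> j _ [a Aa <-]; exists (dcomp j a); first exact: (subc_graded HA).
  by apply/funext => u; rewrite /restr /dcomp even_emb_ucomp.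
- move=> _ [a Aa <-]; have [s [As sa]] := subc_coprod HA Aa.
  exists [seq (restr p.1, restr p.2) | p <- s]; split.
    by move=> _ /mapP[p /As[A1 A2] ->] /=; split; [exists p.1|exists p.2].
  move=> x y; rewrite big_map /restr even_embM -sa.
  by apply: eq_bigr => p _; apply: dpair_restr.
Qed.

Section EvenIntegral.
Variables (A : set (U -> K)) (I0 : (U0 -> K) -> K).
Hypotheses (HA : graded_subcoalgebra A)
  (HI0 : left_integral [set restr a | a in A] I0).
Let I (a : U -> K) : K := I0 (restr a).

Lemma restr_linear_form : linear_form_on A I.
Proof.
move=> c a b Aa Ab.
by rewrite /I -HI0.1 //; [exists a|exists b].
Qed.

Lemma even_translate_invariant (x : U0) a : A a ->
  I (left_translate (even_emb x) a) = counit x * I a.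
Proof.
move=> Aa; have HB := restr_subcoalgebra HA.
rewrite -((left_integralP HB HI0.1).1 HI0); last by exists a.
by congr I0; apply/funext => u; rewrite /restr /left_translate even_embM.
Qed.

Lemma left_translate_lin c (u v : U) a : A a ->
  I (left_translate (c *: u + v) a) =
  c * I (left_translate u a) + I (left_translate v a).
Proof.
move=> Aa; have At w := left_translate_closed w HA Aa.
rewrite -restr_linear_form //; congr I; apply/funext => y.
by rewrite /left_translate mulrDl -scalerAl (subc_lin HA Aa).
Qed.

(** A generator x * iota y of J first translates by x within A and then by an
    element of U(g_0) with zero counit. *)
Lemma left_translate_ideal_J w a : A a -> ideal_J w ->
  I (left_translate w a) = 0.
Proof.
move=> Aa [s [s0 ->]]; elim: s s0 => [_|[x y] s IHs s0].
  rewrite big_nil -[RHS](linear_form_on0 HA restr_linear_form); congr I.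
  apply/funext => u; rewrite /left_translate mul0r.
  exact: lin_zero (subc_lin HA Aa).
rewrite big_cons -[x * _]scale1r left_translate_lin // IHs; last first.
  by move=> p ps; apply: s0; rewrite inE ps orbT.
rewrite addr0 mul1r /=; have y0 : y \in gpart g false.
  exact: (s0 (x, y) (mem_head _ _)).
pose y' : even_lie g := vsproj (gpart g false) y.
have -> : left_translate (x * iota y) a =
    left_translate (even_emb (iota y')) (left_translate x a).
  apply/funext => u.
  by rewrite /left_translate even_emb_iota vsprojK // mulrA.
rewrite even_translate_invariant.
  by rewrite /counit (ulift_iota (lie_map0 _)) mul0r.
exact: left_translate_closed.
Qed.

Lemma left_translate_mod_J u v a : A a -> ideal_J (u - v) ->
  I (left_translate u a) = I (left_translate v a).
Proof.
move=> Aa Juv; rewrite -[u](subrK v) -[u - v]scale1r left_translate_lin //.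
by rewrite (left_translate_ideal_J Aa Juv) mulr0 add0r.
Qed.

Lemma left_integral_nu (z : U) : invariant_mod_J z ->
  left_integral A (form_mul A (nu z) I).
Proof.
move=> /invariant_mod_J_uparity Hz.
have HI := restr_linear_form.
have At w b : A b -> A (left_translate w b) := left_translate_closed w HA.
have lin : linear_form_on A (form_mul A (nu z) I).
  move=> c a b Aa Ab; rewrite !(form_mul_nu HA HI) //; last first.
    exact: (subc_linear HA).
  by rewrite -HI //; apply: At.
apply/(left_integralP HA lin) => a x Aa.
rewrite !(form_mul_nu HA HI) //; last exact: At.
have -> : left_translate (uparity z) (left_translate x a) =
          left_translate (x * uparity z) a.
  by apply/funext => y; rewrite /left_translate mulrA.
rewrite (left_translate_mod_J Aa (Hz x)) -[_ *: _]addr0 left_translate_lin //.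
by rewrite (left_translate_ideal_J Aa (@ideal_J0 _ _)) addr0.
Qed.

(** As w * u = counit u *: w modulo J for u in U(g_0), a form a vanishing on J
    gives, once translated by w and restricted, a w times the counit. *)
Lemma left_translate_coordinate a w : A counit -> I0 counit = 1 ->
  (forall u v, ideal_J (u - v) -> a u = a v) -> linear (a : U -> K^o) ->
  I (left_translate w a) = a w.
Proof.
move=> A1 I01 aJ al.
have -> : I (left_translate w a) = I (fun x => a w * counit x + 0).
  congr I0; apply/funext => u.
  rewrite /restr /left_translate (_ : counit _ = counit u); last first.
    exact: (congr1 (@^~ u) restr_counit).
  have /aJ -> : ideal_J (w * even_emb u - counit u *: w).
    have := ideal_J_mull w (even_emb_counit u).
    by rewrite mulrBr -scalerAr mulr1.
  by rewrite (lin_Z _ _ al) addr0 mulrC.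
rewrite restr_linear_form //; last exact: (subc_zero HA).
rewrite (linear_form_on0 HA restr_linear_form) addr0 /I restr_counit I01.
by rewrite mulr1.
Qed.

End EvenIntegral.

(** * Coordinates in the quotient *)

(** x + J = x (1 + J): the coordinates of x modulo J are matrix elements of U/J
    between the class of 1, with coordinates c, and the basis. *)
Lemma quotient_coordinates {n} {d : 'I_n -> bool} {v : 'I_n -> U}
    {m : 'I_n -> 'I_n -> U -> K} :
  quotient_basis d v -> quotient_matrix v m ->
  exists c : 'I_n -> K, let a i x := \sum_j c j * m i j x in
  (forall x, ideal_J (x - \sum_i a i x *: v i)) /\
  (forall i x y, ideal_J (x - y) -> a i x = a i y).
Proof.
move=> Hv Hm; have [c Jc] := qb_span Hv 1; exists c => a.
have Ja x : ideal_J (x - \sum_i a i x *: v i).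
  have Js : ideal_J (\sum_j c j *: (x * v j - \sum_i m i j x *: v i)).
    by apply: ideal_J_sum => j; apply: ideal_JZ; apply: Hm.
  suff -> : x - \sum_i a i x *: v i = x * (1 - \sum_j c j *: v j)
      + \sum_j c j *: (x * v j - \sum_i m i j x *: v i).
    by apply: ideal_JD => //; apply: ideal_J_mull.
  have -> : \sum_j c j *: (x * v j - \sum_i m i j x *: v i) =
      x * (\sum_j c j *: v j) - \sum_i a i x *: v i.
    rewrite [in RHS](eq_bigr _ (fun i _ => scaler_suml _ _ _ _)) exchange_big.
    rewrite mulr_sumr -sumrB; apply: eq_bigr => j _.
    rewrite scalerBr scalerAr scaler_sumr; congr (_ - _).
    by apply: eq_bigr => i _; rewrite scalerA.
  by rewrite mulrBr mulr1 addrA subrK.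
split=> // i x y Jxy; apply/eqP; rewrite -subr_eq0; apply/eqP.
apply: (qb_free Hv (c := fun i => a i x - a i y)).
have -> : \sum_i (a i x - a i y) *: v i =
    (x - y) - ((x - \sum_i a i x *: v i) - (y - \sum_i a i y *: v i)).
  rewrite opprB addrA subrKA opprB [RHS]addrC subrKA -sumrB.
  by apply: eq_bigr => k _; rewrite scalerBl.
by apply: ideal_JB => //; apply: ideal_JB.
Qed.

End Restriction.

Theorem theorem2 (R : realType) (g : lieSuperalgebra R[i])
    (A : set (uea g -> R[i])) (HA : sub_hopf A)
    (I0 : (uea (even_lie g) -> R[i]) -> R[i])
    (HI0 : left_integral [set restr a | a in A] I0)
    (HI01 : I0 counit = 1)
    (z : uea g) (Hz : invariant_mod_J z) :
  let int_of (w : uea g) := form_mul A (nu w) (fun a => I0 (restr a)) in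
  left_integral A (int_of z) /\
  (forall z' : uea g, ideal_J (z' - z) ->
     forall a, A a -> int_of z' a = int_of z a) /\
  (~ ideal_J z ->
   forall (n : nat) (d : 'I_n -> bool) (v : 'I_n -> uea g)
     (pi : 'I_n -> 'I_n -> uea g -> R[i]),
     quotient_basis d v -> quotient_matrix v pi ->
     (forall i j, A (pi i j)) ->
     exists2 a, A a & int_of z a != 0).
Proof.
move=> int_of; have HA' := sub_hopf_subcoalgebra HA.
have HI := restr_linear_form HI0.
have intE w a : A a -> int_of w a = I0 (restr (left_translate (uparity w) a)).
  exact: (form_mul_nu HA' HI).
split; first exact: left_integral_nu HA' HI0 z Hz.
split=> [z' Jz' a Aa|Jz n d v m Hv Hm Am].
  rewrite !intE //; apply: (left_translate_mod_J HA' HI0) => //.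
  by rewrite -linearB; apply: ideal_J_uparity.
have [c [Jc cJ]] := quotient_coordinates Hv Hm.
pose a i x := \sum_j c j * m i j x.
have Aa i : A (a i).
  pose s := index_enum 'I_n.
  by have [] := linear_form_on_sum HA' HI (s := s) c (fun j _ => Am i j).
have aE i : int_of z (a i) = a i (uparity z).
  rewrite intE //; apply: (left_translate_coordinate HA' HI0 _ _ HI01).
  - exact: sub_one.
  - exact: cJ.
  - exact: (subc_lin HA' (Aa i)).
apply: contrapT => a0; apply: Jz; rewrite -[z]uparityK; apply: ideal_J_uparity.
have ai0 i : a i (uparity z) = 0.
  by rewrite -aE; apply/eqP/negPn/negP => ai; apply: a0; exists (a i).
have := Jc (uparity z); rewrite big1 ?subr0 // => i _.
by rewrite [X in X *: _]ai0 scale0r.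
Qed.
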